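(* For every integer $n\ge 0$, the set of live cells of the Hex-Ulam-Warburton automaton after generation $n$ contains, in each of its six slices, the Sierpinski gasket up to generation $n$. That is, for each of the six slices with its slice coordinates $(x,y)$, every cell with integer coordinates $x,y\ge 0$ such that $x+y\le n$ and $\binom{x+y}{x}$ is odd is live after generation $n$.
   Context: The hexagonal grid is the tiling of the plane by congruent regular hexagons, called cells. Two cells are adjacent (neighbors) if they are distinct and share a side, so each cell has 6 neighbors. The Hex-Ulam-Warburton automaton: at generation 0 exactly one cell, the initial cell (the patriarch), is live. For each $n\ge 0$, a cell that is not live after generation $n$ is born in generation $n+1$ (becomes live) if and only if it is adjacent to exactly one cell that is live after generation $n$; all such births happen simultaneously. Live cells never die. Slices: place the center of the initial cell at the origin and let $e_0,\dots,e_5$ be the vectors, in cyclic order, from the origin to the centers of its six neighbors (consecutive vectors make an angle of $60^\circ$). For $i\in\{0,\dots,5\}$ (indices mod 6), the $i$-th slice is the set of cells with centers $x e_i+y e_{i+1}$ with integers $x,y\ge 0$; $(x,y)$ are the slice coordinates. Neighboring slices share the cells on their common boundary ray. The Sierpinski gasket is regarded as Pascal's triangle modulo 2, row by row: row $m$ ($m\ge 0$) has positions $0,\dots,m$, and position $j$ of row $m$ belongs to the gasket if and only if $\binom{m}{j}$ is odd. Row $m$ is called generation $m$ of the gasket, and the gasket up to generation $n$ consists of rows $0,\dots,n$. The gasket is placed in a slice with its top cell at the initial cell: the cell with slice coordinates $(x,y)$ corresponds to position $x$ of row $x+y$. *)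

(* Defs.v *)
From HB Require Import structures.
From mathcomp Require Import all_boot all_order all_algebra.

Set Implicit Arguments.
Unset Strict Implicit.
Unset Printing Implicit Defensive.

Import GRing.Theory.
Local Open Scope ring_scope.

(* The pair (a, b) stands for the cell centered at a e_0 + b e_1; since e_0    *)
(* and e_1 generate the triangular lattice of centers, cells of the hexagonal  *)
(* grid and pairs of integers correspond one to one, and the initial cell is   *)
(* 0 = (0, 0).                                                                 *)
Definition cell : Type := (int * int)%type.

(* The vectors e_0, ..., e_5 in the basis (e_0, e_1). Consecutive ones are     *)
(* unit vectors (in the distance of adjacent centers) at an angle of 60        *)
(* degrees, hence e_(i+2) = e_(i+1) - e_i.                                     *)
Definition hexdir (i : 'I_6) : cell :=
  nth 0 [:: (1, 0); (0, 1); (-1, 1); (-1, 0); (0, -1); (1, -1)] i.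

Definition neighbors (c : cell) : seq cell := [seq c + hexdir i | i : 'I_6].

Lemma hexdir_rec (i : 'I_6) :
  hexdir (ordS (ordS i)) = hexdir (ordS i) - hexdir i.
Proof. by case: i => [[|[|[|[|[|[|i]]]]]] Hi]. Qed.

(* By this lemma, counting in [neighbors c] counts cells without repetition.   *)
Lemma neighbors_uniq (c : cell) : uniq (neighbors c).
Proof.
rewrite map_inj_uniq ?enum_uniq // => i j /addrI; move: i j.
by move=> [[|[|[|[|[|[|i]]]]]] Hi] [[|[|[|[|[|[|j]]]]]] Hj] // _; apply/val_inj.
Qed.

Fixpoint live (n : nat) (c : cell) : bool :=
  if n is n'.+1 then live n' c || (count (live n') (neighbors c) == 1%N)
  else c == 0.

(* [ordS] is the successor modulo 6, so that slice 5 lies between e_5 and e_0. *)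
Definition slice_cell (i : 'I_6) (x y : nat) : cell :=
  hexdir i *+ x + hexdir (ordS i) *+ y.

(* Position j of row m of Pascal's triangle modulo 2. *)
Definition gasket (m j : nat) : bool := (j <= m)%N && odd 'C(m, j).

(* Main.v *)
Require Import Defs.
From HB Require Import structures.
From mathcomp Require Import all_boot all_order all_algebra.
From mathcomp Require Import zify.

(** The automaton spreads by at most one ring of cells per generation, so a
    cell at distance [m] from the patriarch is not live before generation [m],
    and whether it is born exactly then depends only on its neighbors at
    distance [m - 1].  In the interior of a slice there are two of them,
    [(x - 1, y)] and [(x, y - 1)], and the birth rule asks for exactly one to
    be live: this is addition modulo 2, that is, Pascal's recurrence for the
    parity of ['C(x + y, x)].  On a boundary ray there is a single one, which
    propagates the ones on the sides of Pascal's triangle.  Hence at generation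
    [x + y] the cell [(x, y)] is live exactly when the binomial is odd
    ([live_front]); live cells never die ([live_mono]), which gives all later
    generations.

    The rotation by 60 degrees about the patriarch preserves the automaton
    ([live_rotate60]) and permutes the slices, so only the slice between [e_0]
    and [e_1] needs to be examined. *)

Set Implicit Arguments.
Unset Strict Implicit.
Unset Printing Implicit Defensive.

Import GRing.Theory.
Local Open Scope ring_scope.

Lemma neighborsE (a b : int) :
  neighbors (a, b) =
  [:: (a + 1, b); (a, b + 1); (a - 1, b + 1);
      (a - 1, b); (a, b - 1); (a + 1, b - 1)].
Proof.
rewrite /neighbors /image_mem.
have -> : enum 'I_6 = [seq inord k | k <- iota 0 6].
  apply: (inj_map val_inj); rewrite val_enum_ord -map_comp.
  by rewrite /= !inordK.
rewrite /= /hexdir !inordK //=.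
by congr [:: _; _; _; _; _; _]; congr pair; rewrite /= ?addr0.
Qed.

Lemma live_mono (m n : nat) (c : cell) : (m <= n)%N -> live m c -> live n c.
Proof.
move=> /subnKC <-; elim: (n - m)%N => [|k IHk] live_c; first by rewrite addn0.
by rewrite addnS /= IHk.
Qed.

(** These are three of the six half-planes that cut out the hexagon of radius
    [n].  In the slice between [e_0] and [e_1] the distance to the patriarch
    is the sum of the coordinates; just outside it, next to a boundary ray, the
    distance is a single coordinate. *)
Lemma live_bound (n : nat) (a b : int) :
  live n (a, b) -> [/\ a <= n%:Z, b <= n%:Z & a + b <= n%:Z].
Proof.
elim: n a b => [|n IHn] a b; first by move=> /eqP[-> ->].
rewrite [live _ _]/= => /orP[/IHn[]|count1]; first by split; lia.
have /hasP[[a' b'] nbr /IHn[]] : has (live n) (neighbors (a, b)).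
  by rewrite has_count (eqP count1).
move: nbr; rewrite neighborsE !inE.
by do 5?[case/orP]; move=> /eqP[-> ->]; split; lia.
Qed.

(** In the basis [(e_0, e_1)] the rotation maps [e_0] to [e_1] and [e_1] to
    [e_2 = e_1 - e_0]. *)
Definition rotate60 (c : cell) : cell := (- c.2, c.1 + c.2).

Fact rotate60_is_zmod_morphism : zmod_morphism rotate60.
Proof. by move=> [a b] [c d]; congr pair => /=; lia. Qed.

HB.instance Definition _ :=
  GRing.isZmodMorphism.Build cell cell rotate60 rotate60_is_zmod_morphism.

Lemma rotate60_hexdir (i : 'I_6) : rotate60 (hexdir i) = hexdir (ordS i).
Proof. by case: i => [[|[|[|[|[|[|i]]]]]] Hi]. Qed.

Lemma neighbors_rotate60 (c : cell) :
  perm_eq (neighbors (rotate60 c)) (map rotate60 (neighbors c)).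
Proof.
rewrite /neighbors -map_comp.
rewrite (eq_map (g := (fun i => rotate60 c + hexdir i) \o @ordS 6)); last first.
  by move=> i /=; rewrite (raddfD rotate60) /= rotate60_hexdir.
rewrite map_comp perm_map //; apply: uniq_perm; rewrite ?enum_uniq //.
  by rewrite map_inj_uniq ?enum_uniq //; apply: ordS_inj.
move=> i; rewrite mem_enum; apply/esym/mapP.
by exists (ord_pred i); rewrite ?mem_enum ?ord_predK.
Qed.

Lemma live_rotate60 (n : nat) (c : cell) : live n (rotate60 c) = live n c.
Proof.
elim: n c => [|n IHn] c /=.
  case: c => a b; rewrite /rotate60 /=.
  by apply/eqP/eqP => [[]|[-> ->]] // ? ?; congr pair; lia.
rewrite IHn (permP (neighbors_rotate60 c)) count_map.
by rewrite (eq_count (IHn : preim rotate60 (live n) =1 live n)).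
Qed.

Lemma live_slice_cell (n : nat) (i : 'I_6) (x y : nat) :
  live n (slice_cell i x y) = live n (x%:Z, y%:Z).
Proof.
have rot_slice (j : 'I_6) :
    rotate60 (slice_cell j x y) = slice_cell (ordS j) x y.
  by rewrite /slice_cell (raddfD rotate60) !(raddfMn rotate60) /= !rotate60_hexdir.
case: i; elim=> [|k IHk] lt6.
  congr live; rewrite [LHS]surjective_pairing /slice_cell.
  rewrite !(raddfD fst, raddfD snd) !(raddfMn fst, raddfMn snd) /=.
  by rewrite !mul0rn addr0 add0r !natz.
rewrite -(IHk (ltnW lt6)) -[RHS]live_rotate60 rot_slice.
by congr (live n (slice_cell _ x y)); apply: val_inj; rewrite /= modn_small.
Qed.

(** At generation [m] the line [a + b = m + 1] and what lies beyond it are dead,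
    so only the two neighbors on the line [a + b = m] can be live, and exactly
    one of two is live when their states differ: hence the exclusive or. *)
Lemma live_front_rec (m : nat) (a b : int) :
  a + b = m.+1%:Z ->
  live m.+1 (a, b) = live m (a - 1, b) (+) live m (a, b - 1).
Proof.
move=> sum_ab.
have dead (u v : int) : u + v > m%:Z -> live m (u, v) = false.
  by move=> ?; apply/negP => /live_bound[]; lia.
by rewrite /= neighborsE /= (dead a b) ?(dead (a + 1)) ?(dead _ (b + 1)); lia.
Qed.

(** On a boundary ray one of the two cells in the recurrence lies outside the
    slice, still at distance [x + y], and is therefore dead. *)
Lemma live_front (x y : nat) :
  live (x + y) (x%:Z, y%:Z) = odd 'C(x + y, x).
Proof.
move: {2}(x + y)%N (erefl (x + y)%N) => m; elim: m x y => [|m IHm] x y sum_xy.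
  by have [-> ->] : x = 0%N /\ y = 0%N by lia.
rewrite sum_xy live_front_rec; last by rewrite -sum_xy; lia.
case: x y sum_xy => [|x] [|y] sum_xy //.
- have -> : live m (0%:Z - 1, y.+1%:Z) = false.
    by apply/negP => /live_bound[]; lia.
  have -> : y.+1%:Z - 1 = y%:Z by lia.
  have ym : (0 + y)%N = m by lia.
  by have := IHm 0%N y ym; rewrite ym !bin0.
- have -> : live m (x.+1%:Z, 0%:Z - 1) = false.
    by apply/negP => /live_bound[]; lia.
  have -> : x.+1%:Z - 1 = x%:Z by lia.
  have xm : (x + 0)%N = m by lia.
  have := IHm x 0%N xm; rewrite xm => ->.
  have -> : x = m by lia.
  by rewrite !binn.
have -> : x.+1%:Z - 1 = x%:Z by lia.
have -> : y.+1%:Z - 1 = y%:Z by lia.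
have xm : (x + y.+1)%N = m by lia.
have ym : (x.+1 + y)%N = m by lia.
have := IHm x y.+1 xm; have := IHm x.+1 y ym; rewrite xm ym => -> ->.
by rewrite binS oddD addbC.
Qed.

Theorem theorem2 (n : nat) (i : 'I_6) (x y : nat) :
  (x + y <= n)%N -> gasket (x + y) x -> live n (slice_cell i x y).
Proof.
move=> le_n /andP[_ odd_bin]; rewrite live_slice_cell.
by apply: live_mono le_n _; rewrite live_front.
Qed.
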